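(* Let $r\ge 1$ be an integer, and let $\mathcal{F}^*_r=\{mK_2 \mid 1\le m\le r\}$ be the family of matchings of size at most $r$. If $r\ge 2$ and $p>2r$, or $r=1$ and $p\ge 4$, then $$\mathrm{ex}(n,K_{p-r})+2 \le f(n,K_p|\mathcal{F}^*_r) \le (1+o(1))\,\mathrm{ex}(n,K_{p-r}),$$ where $o(1)\to 0$ as $n\to\infty$. The same bounds are valid if $\mathcal{F}^*_r$ is supplemented with all non-matching triangle-free graphs (connected and disconnected as well); that is, they are valid for $f(n,K_p|\mathcal{F}^*_r\cup\mathcal{T})$, where $\mathcal{T}$ is the family of all triangle-free graphs that are not matchings.
   Context: $mK_2$ is the matching consisting of $m$ disjoint edges. $\mathrm{ex}(n,F)$ is the Turán number: the maximum number of edges in a graph of order $n$ containing no subgraph isomorphic to $F$. In an edge coloring of $K_n$ (not necessarily proper), for a copy $G'\subseteq K_n$ of a graph $G$, a color class of $G'$ is the graph (without isolated vertices) formed by all edges of $G'$ having a given color that occurs in $G'$. For a family $\mathcal{F}$ of graphs (without isolated vertices, closed under isomorphism) with $K_2\in\mathcal{F}$, and $n\ge |G|$, $f(n,G|\mathcal{F})$ is the smallest integer $m$ such that in every edge coloring of $K_n$ using at least $m$ colors there exists a copy of $G$ in which all color classes are members of $\mathcal{F}$. *)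

(* Defs.v *)
From HB Require Import structures.
From mathcomp Require Import all_boot.
From mathcomp Require Import boolp.

Set Implicit Arguments.
Unset Strict Implicit.
Unset Printing Implicit Defensive.

Definition simple_edges (V : finType) (E : {set {set V}}) : bool :=
  [forall e in E, #|e| == 2].

(* [sgraph V]: finite simple graphs with vertex set exactly [V]. *)
Record sgraph (V : finType) := SGraph {
  edges : {set {set V}};
  edges_simple : simple_edges edges
}.

HB.instance Definition _ (V : finType) := [isSub for @edges V].
HB.instance Definition _ (V : finType) := [Finite of sgraph V by <:].

Definition contains (V W : finType) (H : sgraph W) (G : sgraph V) : Prop :=
  exists phi : V -> W,
    injective phi /\ forall e, e \in edges G -> phi @: e \in edges H.

Definition isomorphic (V W : finType) (G : sgraph V) (H : sgraph W) : Prop :=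
  exists phi : V -> W,
    bijective phi /\ forall e : {set V}, (phi @: e \in edges H) = (e \in edges G).

Lemma complete_simple (V : finType) :
  simple_edges [set e : {set V} | #|e| == 2].
Proof. by apply/forall_inP => e; rewrite inE. Qed.

Definition complete (V : finType) : sgraph V := SGraph (complete_simple V).

Definition K (n : nat) : sgraph 'I_n := complete 'I_n.

Lemma matching_simple (m : nat) :
  simple_edges [set [set (i, false); (i, true)] | i : 'I_m].
Proof. by apply/forall_inP => e /imsetP[i _ ->]; rewrite cards2 xpair_eqE andbF. Qed.

Definition mK2 (m : nat) : sgraph ('I_m * bool)%type :=
  SGraph (matching_simple m).

Definition turan_ex (V : finType) (n : nat) (G : sgraph V) : nat :=
  \max_(H : sgraph 'I_n | `[< ~ contains H G >]) #|edges H|.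

Lemma copy_simple (V W : finType) (phi : V -> W) (phi_inj : injective phi)
    (G : sgraph V) :
  simple_edges [set phi @: (e : {set V}) | e in edges G].
Proof.
apply/forall_inP => _ /imsetP[e eG ->]; rewrite card_imset //.
exact: (forall_inP (edges_simple G)).
Qed.

(* The copy of [G] placed on the vertices [phi v]; the other vertices of [W]
   do not belong to the copy but remain as isolated points of the graph. *)
Definition copy (V W : finType) (phi : V -> W) (phi_inj : injective phi)
  (G : sgraph V) : sgraph W := SGraph (copy_simple phi_inj G).

Lemma monochromatic_simple (W : finType) (c : {set W} -> nat) (k : nat)
    (H : sgraph W) :
  simple_edges [set e in edges H | c e == k].
Proof.
apply/forall_inP => e; rewrite inE => /andP[eH _].
exact: (forall_inP (edges_simple H)).
Qed.

Definition monochromatic (W : finType) (c : {set W} -> nat) (k : nat)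
  (H : sgraph W) : sgraph W := SGraph (monochromatic_simple c k H).

Lemma drop_isolated_simple (W : finType) (H : sgraph W) :
  simple_edges
    [set e : {set {x : W | x \in cover (edges H)}} | val @: e \in edges H].
Proof.
apply/forall_inP => e; rewrite inE => eH.
by rewrite -(card_imset _ val_inj) (forall_inP (edges_simple H)).
Qed.

Definition drop_isolated (W : finType) (H : sgraph W) :
  sgraph {x : W | x \in cover (edges H)} := SGraph (drop_isolated_simple H).

Definition color_class (W : finType) (c : {set W} -> nat) (k : nat)
  (H : sgraph W) := drop_isolated (monochromatic c k H).

Definition color_occurs (W : finType) (c : {set W} -> nat) (k : nat)
  (H : sgraph W) : Prop := exists2 e, e \in edges H & c e = k.

(* Colorings of [K n] are functions on all subsets of ['I_n]; only their
   values on edges (2-subsets) matter. *)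
Definition num_colors (n : nat) (c : {set 'I_n} -> nat) : nat :=
  size (undup [seq c e | e <- enum (edges (K n))]).

Definition family := forall V : finType, sgraph V -> Prop.

Definition forces_copy (V : finType) (n : nat) (G : sgraph V) (F : family)
    (m : nat) : Prop :=
  forall c : {set 'I_n} -> nat, m <= num_colors c ->
    exists (phi : V -> 'I_n) (phi_inj : injective phi),
      forall k, color_occurs c k (copy phi_inj G) ->
        F _ (color_class c k (copy phi_inj G)).

Lemma forces_copy_ex (V : finType) (n : nat) (G : sgraph V) (F : family) :
  exists m, `[< forces_copy n G F m >].
Proof.
exists #|edges (K n)|.+1; apply/asboolP => c; rewrite ltnNge.
by rewrite (leq_trans (size_undup _)) // size_map -cardE.
Qed.

(* f(n, G | F) *)
Definition min_colors (V : finType) (n : nat) (G : sgraph V) (F : family) : nat :=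
  ex_minn (forces_copy_ex n G F).

Definition small_matchings (r : nat) : family := fun V G =>
  exists m, 1 <= m <= r /\ isomorphic G (mK2 m).

Definition no_isolated (V : finType) (G : sgraph V) : Prop :=
  forall v : V, exists2 e, e \in edges G & v \in e.

Definition is_matching (V : finType) (G : sgraph V) : Prop :=
  exists m, isomorphic G (mK2 m).

(* Families consist of graphs without isolated vertices, hence the first
   conjunct. *)
Definition nonmatching_triangle_free : family := fun V G =>
  [/\ no_isolated G, ~ contains G (K 3) & ~ is_matching G].

Definition family_union (F1 F2 : family) : family := fun V G =>
  F1 V G \/ F2 V G.

(* Main.v *)
Require Import Defs.
From mathcomp Require Import all_boot all_order all_algebra.
From mathcomp Require Import boolp classical_sets reals topology normedtype sequences.
From mathcomp Require Import zify.
Import numFieldNormedType.Exports.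
Import boot.fintype boot.finset.

(** Write [s = p - r - 1], so that [ex(n, K_(p-r))] is attained by a complete
    [s]-partite graph (Turan), [s >= 2] and [r <= s + 1 = p - r].

    Lower bound ([turan_lower]).  Colour the edges of an extremal complete
    [s]-partite graph with pairwise distinct colours and all other pairs with
    one more colour, [0].  In a copy of [K_p] the colour class of [0] is the
    disjoint union of the complete graphs on the traces of the at most [s]
    parts.  Its number of edges is at least [p - s = r + 1], hence it is not a
    matching of size at most [r]; and if it has no triangle, the traces have at
    most two vertices, hence it is a matching.  So [ex + 1] colours do not force
    a good copy, whichever of the two families is allowed.  That the extremal
    graph can be taken complete multipartite is essential for the second family.

    Upper bound ([forces_many_colors]).  Keep one edge of each colour.  If the
    number of colours is at least [(1 + epsilon) ex(n, K_(s+1))], this rainbow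
    graph has enough edges for the Erdos-Stone theorem, and so contains a complete
    [(s+1)]-partite graph with parts of any prescribed constant size.  Take two
    vertices in [r] of the parts and one in each of the others: [s + 1 + r = p]
    vertices.  The edges between different parts have pairwise distinct colours,
    and the [r] edges inside parts form a matching; the colour classes are
    therefore matchings of size at most [r] as soon as no edge inside a part
    shares its colour with an edge between chosen vertices of different parts.
    A colour occurs on at most one edge between parts, so each candidate pair has
    at most one conflict, and counting gives a choice without conflicts
    ([conflict_free_choice]).

    The Erdos-Stone theorem ([erdos_stone]) is proved in three steps: a dense
    graph has a large subset in which every degree is large
    ([dense_subset_min_degree]); there, choosing vertices one after another gives
    a positive proportion of all [(s+1)]-tuples as cliques ([clique_count]); and a
    relation that holds for a positive proportion of all [k]-tuples holds on a
    product of [k] sets of prescribed size ([dense_box]).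

    Finally [o n] is chosen as [f n / ex n - 1], where [f n] is the number of
    colours in question; it tends to [0] because [ex n] is of order [n ^ 2], so
    that rounding to integers costs nothing in the limit. *)

Set Implicit Arguments.
Unset Strict Implicit.
Unset Printing Implicit Defensive.

(** * Dense relations contain boxes *)

Lemma pigeonhole_sum (I : finType) (B : {set I}) (F : I -> nat) (a : nat) :
  0 < a -> a <= \sum_(i in B) F i -> exists2 i, i \in B & a <= #|B| * F i.
Proof.
move=> a_gt0 le_a; have [B0 | [i0 i0B]] := set_0Vmem B.
  by move: le_a; rewrite B0 big_set0 leqNgt a_gt0.
have [i iB maxi] := arg_maxnP F i0B.
exists i => //; apply: leq_trans le_a _.
by rewrite -sum_nat_const; apply: leq_sum.
Qed.

Lemma sub_card_exists (T : finType) (B : {set T}) (m : nat) :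
  m <= #|B| -> exists2 A : {set T}, A \subset B & #|A| = m.
Proof.
move/card_geqP => [l [l_uniq <- l_sub]].
exists [set x in l]; last by rewrite cardsE; apply/card_uniqP.
by apply/subsetP => x; rewrite inE => /l_sub.
Qed.

(** The sum of [f] over all lists of length [k], by recursion on [k] so that
    fixing the head of the list needs no reindexing. *)
Fixpoint sum_seqs (V : finType) (k : nat) (f : seq V -> nat) : nat :=
  if k is k'.+1 then \sum_(x : V) sum_seqs k' (fun l => f (x :: l)) else f [::].

Lemma leq_sum_seqs (V : finType) k (f g : seq V -> nat) :
  (forall l, size l = k -> f l <= g l) -> sum_seqs k f <= sum_seqs k g.
Proof.
elim: k f g => [|k IH] f g le_fg /=; first exact: le_fg.
by apply: leq_sum => x _; apply: IH => l l_k; apply: le_fg; rewrite /= l_k.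
Qed.

Lemma eq_sum_seqs (V : finType) k (f g : seq V -> nat) :
  f =1 g -> sum_seqs k f = sum_seqs k g.
Proof.
by move=> eq_fg; apply/eqP; rewrite eqn_leq; apply/andP; split;
  apply: leq_sum_seqs => l _; rewrite eq_fg.
Qed.

Lemma sum_seqsD (V : finType) k (f g : seq V -> nat) :
  sum_seqs k (fun l => f l + g l) = sum_seqs k f + sum_seqs k g.
Proof. by elim: k f g => //= k IH f g; rewrite -big_split; apply: eq_bigr. Qed.

Lemma sum_seqsM (V : finType) k c (f : seq V -> nat) :
  sum_seqs k (fun l => c * f l) = c * sum_seqs k f.
Proof. by elim: k f => //= k IH f; rewrite big_distrr; apply: eq_bigr. Qed.

Lemma sum_seqs_const (V : finType) k c :
  sum_seqs k (fun _ : seq V => c) = #|V| ^ k * c.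
Proof.
elim: k => [|k IH] /=; first by rewrite mul1n.
by rewrite IH sum_nat_const expnS mulnA.
Qed.

Lemma sum_seqs_sum (V I : finType) k (B : {set I}) (F : I -> seq V -> nat) :
  sum_seqs k (fun l => \sum_(i in B) F i l) = \sum_(i in B) sum_seqs k (F i).
Proof.
elim: k F => //= k IH F; rewrite exchange_big /=.
by apply: eq_bigr => x _; rewrite IH.
Qed.

Definition in_box (V : finType) (As : seq {set V}) (l : seq V) : bool :=
  all2 (fun x (A : {set V}) => x \in A) l As.

(** The [k]-partite form of the theorem of Kovari, Sos and Turan, due to Erdos:
    [P] holds on at least [n ^ k / q] of the [n ^ k] lists of length [k], and so
    on a product of [k] sets of size [t].  By induction on [k]: a constant number
    [M] of vertices [x] that head many lists are fixed; a positive proportion of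
    the tails [l] extend at least [t] of them, and as there are at most [2 ^ M]
    sets of [t] such vertices, one of these sets serves a positive proportion of
    the tails. *)
Lemma dense_box t k q : 0 < t -> exists N, forall (V : finType) (P : pred (seq V)),
  N <= #|V| -> #|V| ^ k <= q * sum_seqs k P ->
  exists2 As : seq {set V}, size As = k /\ all [pred A : {set V} | #|A| == t] As
    & forall l, in_box As l -> P l.
Proof.
move=> t_gt0; elim: k q => [|k IH] q.
  exists 0 => V P _ /=; rewrite expn0 muln_gt0 lt0b => /andP[_ Pnil].
  by exists [::] => // -[].
(* With [M = 4 q t] the tails extending fewer than [t] vertices of [X] account
   for at most half of the [M n ^ k / (2 q)] pairs (head in [X], tail). *)
set M := 4 * q * t; have [N0 box] := IH (4 * q * 2 ^ M).
exists (N0 + 2 * q * M + 1) => V P leN dense.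
set n := #|V| in leN dense; set cnt := fun x => sum_seqs k (fun l => P (x :: l)).
have n_gt0 : 0 < n by lia.
have nk_gt0 : 0 < n ^ k by rewrite expn_gt0 n_gt0.
have q_gt0 : 0 < q by case: (q) dense => //; rewrite mul0n leqNgt expn_gt0 n_gt0.
have cnt_le x : cnt x <= n ^ k.
  rewrite -[n ^ k]muln1 -(sum_seqs_const V); apply: leq_sum_seqs => l _.
  exact: leq_b1.
(* Heads of at least [n ^ k / (2 q)] lists each; they carry at least half of all
   lists in [P], hence are at least [n / (2 q)] many. *)
have [X XY cardX] : exists2 X : {set V},
    X \subset [set x | n ^ k <= 2 * q * cnt x] & #|X| = M.
  apply: sub_card_exists; set Y := finset _.
  suff leY : n <= 2 * q * #|Y|.
    have : 2 * q * M <= 2 * q * #|Y| by lia.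
    by rewrite leq_pmul2l // muln_gt0.
  have le1 : 2 * q * \sum_x cnt x <= 2 * q * (#|Y| * n ^ k) + n * n ^ k.
    rewrite (bigID (fun x => x \in Y)) /= mulnDr leq_add //.
      rewrite leq_mul2l; apply/orP; right.
      by rewrite -sum_nat_const; apply: leq_sum => x _.
    rewrite big_distrr /= -sum_nat_const.
    rewrite [leqRHS](bigID (fun x => x \in Y)) /=.
    apply: leq_trans (leq_addl _ _); apply: leq_sum => x.
    by rewrite inE -ltnNge => /ltnW.
  have : 2 * (n * n ^ k) <= 2 * q * (#|Y| * n ^ k) + n * n ^ k.
    apply: leq_trans le1; rewrite -mulnA leq_mul2l /=.
    by rewrite -expnS.
  rewrite mul2n -addnn leq_add2r mulnA leq_pmul2r //.
pose d l := \sum_(x in X) (P (x :: l) : nat).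
pose good l := t <= d l.
have le_good : n ^ k <= 4 * q * sum_seqs k (fun l => good l).
  have le1 : M * n ^ k <= 2 * q * sum_seqs k d.
    rewrite sum_seqs_sum big_distrr /= -cardX -sum_nat_const.
    apply: leq_sum => x xX; have := subsetP XY x xX; rewrite inE.
    exact.
  have le2 : sum_seqs k d <= M * sum_seqs k (fun l => good l) + n ^ k * t.
    rewrite -(sum_seqs_const V) -sum_seqsM -sum_seqsD.
    apply: leq_sum_seqs => l _; rewrite /good; case: (leqP t (d l)) => [_|/ltnW]; last by rewrite muln0.
    rewrite muln1 (leq_trans _ (leq_addr _ _)) // -cardX -sum1_card.
    by apply: leq_sum => x _; apply: leq_b1.
  have : 2 * q * t * (n ^ k) <= 2 * q * t * (4 * q * sum_seqs k (fun l => good l)).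
    rewrite /M in le1 le2; move: (n ^ k) (sum_seqs _ _) (sum_seqs _ _) le1 le2 => a b e.
    nia.
  by rewrite leq_pmul2l ?muln_gt0 ?q_gt0.
(* Pigeonhole over the [t]-subsets of [X]: each good tail admits one of them. *)
pose F := [set A in powerset X | #|A| == t].
pose PA (A : {set V}) l := [forall x in A, P (x :: l)].
have [A] : exists2 A : {set V}, A \in F &
    n ^ k <= #|F| * (4 * q * sum_seqs k (fun l => PA A l)).
  apply: pigeonhole_sum => //; apply: leq_trans le_good _.
  rewrite -big_distrr leq_mul2l -sum_seqs_sum; apply/orP; right.
  apply: leq_sum_seqs => l _; case: (boolP (good l)) => // good_l.
  have [A sA cA] : exists2 A : {set V}, A \subset [set x in X | P (x :: l)] & #|A| = t.
    apply: sub_card_exists; apply: leq_trans good_l _.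
    rewrite /d -sum1_card [leqRHS]big_mkcond [leqLHS]big_mkcond.
    by apply: leq_sum => x _; rewrite inE; case: (x \in X); case: (P _).
  have AF : A \in F.
    rewrite inE cA eqxx andbT powersetE; apply: subset_trans sA _.
    by apply/subsetP => x; rewrite inE => /andP[].
  rewrite (bigD1 A) //= (leq_trans _ (leq_addr _ _)) // lt0b.
  by apply/forall_inP => x /(subsetP sA); rewrite inE => /andP[].
rewrite inE => /andP[_ /eqP cA] denseA.
have [||As [sAs cAs] inP] := box V (PA A).
- by rewrite -/n; lia.
- rewrite -/n; apply: leq_trans denseA _.
  rewrite mulnA leq_mul2r; apply/orP; right.
  rewrite mulnC leq_mul2l; apply/orP; right.
  rewrite -cardX -card_powerset; apply: subset_leq_card.
  by apply/subsetP => B; rewrite inE => /andP[].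
exists (A :: As) => [|[|x l]] //=; first by rewrite sAs cA eqxx.
by move=> /andP[xA /inP/forall_inP]; apply.
Qed.

(** * The Erdos-Stone theorem *)

Lemma common_neighbors (V : finType) (adj : rel V) (S : {set V}) (l : seq V) :
  #|S| <= #|[set x in S | all (adj x) l]|
          + \sum_(y <- l) #|[set x in S | ~~ adj x y]|.
Proof.
elim: l => [|y l IH].
  by rewrite big_nil addn0 subset_leq_card //; apply/subsetP => x xS; rewrite inE xS.
rewrite big_cons addnCA (leq_trans IH) // addnA leq_add2r -cardsUI.
rewrite (leq_trans _ (leq_addr _ _)) // subset_leq_card //.
apply/subsetP => x; rewrite !inE /= => /andP[-> ->].
by case: (adj x y).
Qed.

(** Each vertex misses at most the fraction [(1 - 1/q) / s] of [S], so [k <= s]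
    vertices have at least [#|S| / q] common neighbours in [S]: every clique
    with [k] vertices extends in that many ways. *)
Lemma clique_count (V : finType) (adj : rel V) (S : {set V}) q s : 0 < s ->
  (forall y, y \in S ->
     q * s * #|[set x in S | ~~ adj x y]| + #|S| <= q * #|S|) ->
  forall k, k <= s.+1 -> #|S| ^ k <=
    q ^ k * sum_seqs k (fun l => all (mem S) l && pairwise adj l).
Proof.
move=> s_gt0 few; elim=> [|k IH] // lt_ks.
rewrite !expnS; apply: leq_trans (leq_mul (leqnn _) (IH (ltnW lt_ks))) _.
rewrite mulnCA [q * q ^ k]mulnC -mulnA leq_mul2l; apply/orP; right => /=.
pose f : pred (seq V) := fun l => all (mem S) l && pairwise adj l.
rewrite -[X in sum_seqs k X]/(fun l => nat_of_bool (f l)).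
have -> : \sum_x sum_seqs k (fun l => [&& (x \in S) && all (mem S) l,
      all (adj x) l & pairwise adj l])
    = sum_seqs k (fun l => \sum_(x in S) (f l && all (adj x) l : nat)).
  rewrite sum_seqs_sum [RHS]big_mkcond /=; apply: eq_bigr => x _.
  case: ifP => xS.
    by apply: eq_sum_seqs => l; rewrite /f /=; case: (all (mem S) l); case: (all (adj x) l); case: pairwise.
  by rewrite (@eq_sum_seqs _ _ _ (fun=> 0)) // sum_seqs_const muln0.
rewrite -!sum_seqsM; apply: leq_sum_seqs => l size_l.
case fl: (f l); last by rewrite muln0.
rewrite muln1; have /andP[/allP lS _] := fl.
have := common_neighbors adj S l.
have -> : \sum_(x in S) (true && all (adj x) l : nat) = #|[set x in S | all (adj x) l]|.
  rewrite -sum1_card big_mkcond [RHS]big_mkcond.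
  by apply: eq_bigr => x _; rewrite inE; case: (x \in S); case: all.
set A := #|_|; set B := \sum_(_ <- _) _ => le_SAB.
have leB : s * (q * B + #|S|) <= s * (q * #|S|).
  case: (posnP q) => [q0 | q_gt0].
    have [S0|[y yS]] := set_0Vmem S; first by rewrite S0 cards0 q0.
    by have := few y yS; rewrite q0; lia.
  have leB1 : s * (q * B) <= size l * (q * #|S| - #|S|).
    rewrite /B; elim: (l) lS => [|y l' IHl] lS; first by rewrite big_nil !muln0.
    rewrite big_cons /= mulSn !mulnDr leq_add //.
      have := few y (lS y (mem_head _ _)).
      by rewrite mulnCA mulnA; lia.
    by apply: IHl => z zl; apply: lS; rewrite inE zl orbT.
  have leS : size l * (q * #|S| - #|S|) <= s * (q * #|S| - #|S|).
    by rewrite leq_mul2r; lia.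
  have : #|S| <= q * #|S| by rewrite leq_pmull.
  nia.
rewrite leq_pmul2l // in leB.
nia.
Qed.

(** Non-adjacent ordered pairs, loops included, are counted, and their proportion
    [(1 - 2/q) / s] in [V] becomes [(1 - 1/q) / s] for the non-neighbours of each
    vertex of [S], up to a rounding term.  Take [S] that minimises the excess [h]
    of non-adjacent pairs over the proportion [(1 - 1/q) / s]: removing a vertex
    with too many non-neighbours would decrease [h], and [S] cannot be small since
    [h] is well below its value at the empty set already at [V]. *)
Lemma dense_subset_min_degree (V : finType) (adj : rel V) q s :
  symmetric adj -> irreflexive adj ->
  s * q * (\sum_(x : V) \sum_(y : V) ~~ adj x y) + 2 * #|V| ^ 2 <= q * #|V| ^ 2 ->
  exists2 S : {set V}, #|V| <= q * #|S| &
    forall y, y \in S ->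
      2 * s * q * #|[set x in S | ~~ adj x y]| + 2 * #|S| <= 2 * q * #|S| + s * q.
Proof.
move=> adj_sym adj_irr dense.
pose F (S : {set V}) := \sum_(x in S) \sum_(y in S) (~~ adj x y : nat).
(* The constant [#|V| ^ 2] only keeps the subtraction inside the naturals. *)
pose h (S : {set V}) := s * q * F S + q.-1 * (#|V| ^ 2 - #|S| ^ 2).
have [S _ minS] := @arg_minnP _ [set: V] xpredT h isT.
have leS2 (A : {set V}) : #|A| ^ 2 <= #|V| ^ 2 by rewrite leq_exp2r // max_card.
have hT : h [set: V] = s * q * (\sum_(x : V) \sum_(y : V) ~~ adj x y).
  rewrite /h cardsT subnn muln0 addn0; congr (_ * _); rewrite /F.
  apply: eq_big => [x|x _]; rewrite ?inE //.
  by apply: eq_bigl => y; rewrite inE.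
exists S => [|y yS].
  have := minS [set: V] isT; rewrite hT /h => le_h.
  have := leS2 S; move: dense le_h.
  move: (s * q * F S) (s * q * \sum_x _) => a b.
  have [->|V_gt0] := posnP #|V|; first by rewrite leq0n.
  rewrite -(@leq_exp2r #|V| _ 2) // expnMn.
  move: (#|S| ^ 2) (#|V| ^ 2) => u v.
  case: (q) => [|q'] /=; first by lia.
  rewrite mulnBr mulSn => le_b le_a le_uv.
  have : q' * u <= q' * v by rewrite leq_mul2l le_uv orbT.
  have : q' * u <= q'.+1 ^ 2 * u by rewrite leq_mul2r -mulnn; lia.
  lia.
have V_gt0 : 0 < #|V| by apply/card_gt0P; exists y.
have q_gt0 : 0 < q.
  case: (q) dense => //; rewrite muln0 !mul0n add0n leqn0 muln_eq0 /= expn_eq0 andbT.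
  by rewrite eqn0Ngt V_gt0.
have := minS (S :\ y) isT; rewrite /h.
have cS := cardsD1 y S; rewrite yS add1n in cS.
(* The pair [(y, y)] is counted twice in the last term. *)
have FS : F S + 1 = F (S :\ y) + 2 * #|[set x in S | ~~ adj x y]|.
  have cardE : #|[set x in S | ~~ adj x y]| = 1 + \sum_(x in S :\ y) (~~ adj x y : nat).
    rewrite (cardsD1 y) inE yS adj_irr /=; congr (_ + _).
    rewrite -sum1_card big_mkcond [RHS]big_mkcond.
    apply: eq_bigr => x _; rewrite !inE.
    by case: eqP; case: (x \in S); case: (adj _ _).
  rewrite cardE /F (big_setD1 y) //= (big_setD1 y (A := S)) //= adj_irr /=.
  have -> : \sum_(i in S :\ y) \sum_(j in S) (~~ adj i j : nat) =
    \sum_(x in S :\ y) (~~ adj x y : nat) +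
    \sum_(i in S :\ y) \sum_(j in S :\ y) (~~ adj i j : nat).
    by rewrite -big_split; apply: eq_bigr => x _; rewrite (big_setD1 y).
  under eq_bigr do rewrite adj_sym.
  lia.
have := leS2 S; rewrite cS.
move: FS; move: (F S) (F (S :\ y)) #|S :\ y| (#|finset _|) (#|V| ^ 2) => a b d e v.
case: q q_gt0 {dense hT minS h} => [//|q] _ /=.
rewrite !mulnBr => FS le_v.
have le2 : q * (d.+1 ^ 2) <= q * v by rewrite leq_mul2l le_v orbT.
have : q * d ^ 2 <= q * (d.+1 ^ 2) by rewrite leq_mul2l leq_exp2r // leqnSn orbT.
have -> : q * (d.+1 ^ 2) = q * d ^ 2 + 2 * (q * d) + q by rewrite -mulnn; nia.
have keE : s * q.+1 * a + s * q.+1 = s * q.+1 * b + 2 * (s * q.+1 * e).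
  by rewrite -[X in _ + X = _]muln1 -mulnDr FS mulnDr; congr (_ + _); rewrite mulnCA.
have -> : 2 * s * q.+1 * e = 2 * (s * q.+1 * e) by rewrite -!mulnA.
move: (s * q.+1) (s * q.+1 * b) (s * q.+1 * a) (s * q.+1 * e) keE le2 => k kb ka ke.
lia.
Qed.

(** The density hypothesis reads: at most the fraction [(1 - 2/q) / s] of the
    ordered pairs are non-adjacent, against [1 / s] in the balanced complete
    [s]-partite graph. *)
Theorem erdos_stone s t q : 0 < s -> 0 < t -> exists N,
  forall (V : finType) (adj : rel V), symmetric adj -> irreflexive adj ->
  N <= #|V| ->
  s * q * (\sum_(x : V) \sum_(y : V) ~~ adj x y) + 2 * #|V| ^ 2 <= q * #|V| ^ 2 ->
  exists2 As : seq {set V}, size As = s.+1 /\ all [pred A : {set V} | #|A| == t] As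
    & forall l, in_box As l -> pairwise adj l.
Proof.
move=> s_gt0 t_gt0.
have [N box] := @dense_box t s.+1 ((q * (2 * q)) ^ s.+1) t_gt0.
exists (N + s * q * q + 1) => V adj adj_sym adj_irr leN dense.
have q_gt0 : 0 < q.
  case: (q) dense => //; rewrite muln0 !mul0n add0n leqn0 muln_eq0 /= expn_eq0 andbT.
  by rewrite eqn0Ngt (leq_trans _ leN) // addn1.
have [S leS degS] := dense_subset_min_degree adj_sym adj_irr dense.
(* Large enough to absorb the rounding term [s * q] in [degS]. *)
have sqS : s * q <= #|S|.
  rewrite -(leq_pmul2l q_gt0); apply: leq_trans leS; lia.
have few y : y \in S ->
    2 * q * s * #|[set x in S | ~~ adj x y]| + #|S| <= 2 * q * #|S|.
  move=> yS; have := degS y yS; have -> : 2 * s * q = 2 * q * s by lia.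
  lia.
have cliques := clique_count s_gt0 few (leqnn _).
have [||As cAs inP] := box V (fun l => all (mem S) l && pairwise adj l).
- lia.
- apply: leq_trans (_ : (q * #|S|) ^ s.+1 <= _); first by rewrite leq_exp2r.
  by rewrite !expnMn -mulnA leq_mul2l -expnMn cliques orbT.
by exists As => // l /inP/andP[].
Qed.

(** * Turan's theorem and complete multipartite graphs *)

Lemma card_ordered_edges (V : finType) (E : {set {set V}}) : simple_edges E ->
  \sum_(x : V) \sum_(y : V) ([set x; y] \in E : nat) = 2 * #|E|.
Proof.
move=> /forall_inP simpleE.
rewrite pair_big_dep /=.
rewrite (eq_bigr (fun u : V * V => if [set u.1; u.2] \in E then 1 else 0)); last first.
  by move=> u _; case: ifP.
rewrite -big_mkcond /= (partition_big (fun u : V * V => [set u.1; u.2]) (mem E)) //=.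
rewrite mulnC -sum_nat_const; apply: eq_bigr => e eE.
have /cards2P [a [b [neq_ab e_ab]]] := simpleE e eE.
have -> : 2 = #|[set (a, b); (b, a)]|.
  by rewrite cards2 xpair_eqE (negbTE neq_ab).
rewrite -sum1_card; apply: eq_bigl => -[x y] /=; rewrite !inE !xpair_eqE.
apply/andP/idP => [[_ /eqP exy]|].
  have : x \in e by rewrite -exy !inE eqxx.
  have : y \in e by rewrite -exy !inE eqxx orbT.
  have : x != y.
    apply/eqP => xy; have := simpleE e eE.
    by rewrite -exy xy setUid cards1.
  rewrite e_ab !inE => neq_xy /orP[] /eqP yE /orP[] /eqP xE;
    by move: neq_xy; rewrite xE yE !eqxx ?orbT.
by case/orP => /andP[/eqP-> /eqP->]; rewrite -?e_ab 1?setUC -?e_ab eqxx; split.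
Qed.

(** Turan's theorem in the form of Erdos, for ordered pairs.  The neighbourhood [B]
    of a vertex of maximal degree contains no clique with one vertex less, so it
    is partitioned by induction; [A :\: B] becomes one more part, joined to all of
    [B].  The pairs meeting [A :\: B] are counted by degrees, and each of these
    degrees is at most [#|B|]. *)
Lemma turan_partition (V : finType) (adj : rel V) s (A : {set V}) :
  symmetric adj -> irreflexive adj ->
  (forall l, {subset l <= A} -> pairwise adj l -> size l <= s) ->
  exists2 q : V -> nat, (forall x, x \in A -> q x < s) &
    \sum_(x in A) \sum_(y in A) (adj x y : nat)
      <= \sum_(x in A) \sum_(y in A) (q x != q y : nat).
Proof.
move=> adj_sym adj_irr; elim: s A => [|s IH] A free.
  have [->|[x xA]] := set_0Vmem A; first by exists (fun=> 0) => [x|]; rewrite ?inE ?big_set0.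
  have sub : {subset [:: x] <= A} by move=> y; rewrite inE => /eqP->.
  by have := free _ sub isT.
have [->|[x0 x0A]] := set_0Vmem A; first by exists (fun=> 0) => [x|]; rewrite ?inE ?big_set0.
pose deg x := \sum_(y in A) (adj x y : nat).
have [v vA maxv] := arg_maxnP deg x0A.
pose B := [set y in A | adj v y].
have [|q q_lt le_q] := IH B.
  move=> l lB cl; apply: (free (v :: l)).
    move=> x; rewrite inE => /orP[/eqP-> //|/lB].
    by rewrite inE => /andP[].
  by rewrite /= cl andbT; apply/allP => x /lB; rewrite inE => /andP[].
exists (fun x => if x \in B then q x else s) => [x xA|].
  by case: ifP => [/q_lt /ltnW|].
have cardB : #|B| = deg v.
  rewrite -sum1_card big_mkcond [RHS]big_mkcond; apply: eq_bigr => x _.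
  by rewrite inE; case: (x \in A); case: (adj v x).
(* The second summand counts the pairs between [B] and its complement in one
   direction, the third one those in the other direction and those outside [B]. *)
have split (r : rel V) : symmetric r ->
  \sum_(x in A) \sum_(y in A) (r x y : nat) =
   \sum_(x in B) \sum_(y in B) (r x y : nat)
   + \sum_(x in A :\: B) \sum_(y in B) (r x y : nat)
   + \sum_(x in A :\: B) \sum_(y in A) (r x y : nat).
  move=> r_sym; have AB : A :&: B = B.
    by apply/setIidPr/subsetP => x; rewrite inE => /andP[].
  rewrite (big_setID B) /= AB; congr (_ + _).
  rewrite [X in _ = _ + X]exchange_big -big_split /=; apply: eq_bigr => x _.
  rewrite (big_setID B) /= AB; congr (_ + _).
  by apply: eq_bigr => y _; rewrite r_sym.
rewrite (split adj) // (split (fun x y => _ != _)); last first.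
  by move=> x y; rewrite eq_sym.
have notB x y : x \in A :\: B -> y \in B ->
    (if x \in B then q x else s) != (if y \in B then q y else s).
  rewrite inE => /andP[/negbTE-> _] yB; rewrite yB neq_ltn.
  by rewrite q_lt ?orbT.
rewrite !leq_add //.
- apply: leq_trans le_q _; apply: leq_sum => x xB; apply: leq_sum => y yB.
  by rewrite xB yB.
- apply: leq_sum => x xB; apply: leq_sum => y yB.
  by rewrite notB //; case: (adj x y).
- apply: leq_sum => x xB.
  have xA : x \in A by move: xB; rewrite inE => /andP[].
  apply: leq_trans (maxv x xA) _; rewrite -cardB -sum1_card.
  rewrite big_mkcond [leqRHS]big_mkcond; apply: leq_sum => y _.
  case: ifP => // yB; have -> : y \in A by move: yB; rewrite inE => /andP[].
  by have := notB _ _ xB yB; rewrite yB => ->.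
Qed.

Definition adj_of (V : finType) (E : {set {set V}}) : rel V :=
  fun x y => [set x; y] \in E.

Lemma adj_of_sym (V : finType) (E : {set {set V}}) : symmetric (adj_of E).
Proof. by move=> x y; rewrite /adj_of setUC. Qed.

Lemma adj_of_irr (V : finType) (E : {set {set V}}) :
  simple_edges E -> irreflexive (adj_of E).
Proof.
by move=> /forall_inP simpleE x; apply/negP => /simpleE; rewrite setUid cards1.
Qed.

Definition cross_edges (V : finType) (q : V -> nat) : {set {set V}} :=
  [set [set u.1; u.2] | u in [set u : V * V | q u.1 != q u.2]].

Lemma mem_cross (V : finType) (q : V -> nat) x y :
  ([set x; y] \in cross_edges q) = (q x != q y).
Proof.
apply/imsetP/idP => [[[a b]]|qxy]; last by exists (x, y) => //; rewrite inE.
rewrite inE /= => qab exy.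
have xab : x \in [set a; b] by rewrite -exy !inE eqxx.
have yab : y \in [set a; b] by rewrite -exy !inE eqxx orbT.
have aE : a \in [set x; y] by rewrite exy !inE eqxx.
have bE : b \in [set x; y] by rewrite exy !inE eqxx orbT.
apply: contraNneq qab => qxy.
by move: aE bE; rewrite !inE => /orP[] /eqP-> /orP[] /eqP->; rewrite ?qxy.
Qed.

Lemma cross_simple (V : finType) (q : V -> nat) : simple_edges (cross_edges q).
Proof.
apply/forall_inP => e /imsetP[[x y]]; rewrite inE /= => qxy ->.
by rewrite cards2; case: (eqVneq x y) qxy => // ->; rewrite eqxx.
Qed.

Definition cross_graph (V : finType) (q : V -> nat) := SGraph (cross_simple q).

Lemma pigeonhole_nat (T : finType) (q : T -> nat) s : (forall x, q x < s) -> s < #|T| ->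
  exists x y, x != y /\ q x = q y.
Proof.
move=> q_lt lt_sT.
have : ~~ injectiveb (fun x => Ordinal (q_lt x)).
  apply: contraL lt_sT => /injectiveP inj_q; rewrite -leqNgt.
  by rewrite -[s]card_ord; apply: leq_card inj_q.
case/injectivePn => x [y neq /(congr1 val) eq_q].
by exists x, y.
Qed.

Lemma contains_K (V : finType) (H : sgraph V) k (l : seq V) :
  pairwise (adj_of (edges H)) l -> k <= size l -> contains H (K k).
Proof.
move=> clique le_k.
have l_uniq : uniq l.
  rewrite uniq_pairwise; apply: sub_pairwise clique => x y.
  by apply: contraTneq => ->; rewrite adj_of_irr //; apply: edges_simple.
case: k le_k => [|k] le_k.
  exists (fun i : 'I_0 => False_rect _ (notF (ltn_ord i))); split=> [[]|e] //.
  by rewrite inE => /cards2P[[]].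
have [x0 _] : exists x, x \in l by case: (l) le_k => // x l' _; exists x; rewrite mem_head.
exists (fun i : 'I_k.+1 => nth x0 l i); split.
  move=> i j /eqP; rewrite nth_uniq ?(leq_trans (ltn_ord _)) // => /eqP.
  exact: val_inj.
move=> e; rewrite inE => /cards2P[i [j [neq_ij ->]]].
rewrite imsetU !imset_set1.
have adjP (a b : 'I_k.+1) : a < b -> adj_of (edges H) (nth x0 l a) (nth x0 l b).
  move=> lt_ab; apply: (pairwiseP x0 clique) => //;
    by rewrite inE (leq_trans (ltn_ord _)).
have := neq_ij; rewrite neq_ltn => /orP[/adjP//|/adjP].
by rewrite /adj_of setUC.
Qed.

Lemma adj_nonadj_sum (V : finType) (adj : rel V) :
  \sum_x \sum_y (adj x y : nat) + \sum_x \sum_y (~~ adj x y : nat) = #|V| ^ 2.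
Proof.
rewrite -big_split /= (eq_bigr (fun=> #|V|)) => [|x _].
  by rewrite sum_nat_const.
rewrite -big_split /= -sum1_card; apply: eq_bigr => y _.
by case: adj.
Qed.

Lemma cross_edges_max n s (H : sgraph 'I_n) : ~ contains H (K s.+1) ->
  exists2 q : 'I_n -> nat, (forall x, q x < s) & #|edges H| <= #|cross_edges q|.
Proof.
move=> freeH.
have [|q q_lt le_q] := @turan_partition _ (adj_of (edges H)) s [set: 'I_n]
  (@adj_of_sym _ _) (adj_of_irr (edges_simple H)).
  move=> l _ cl; rewrite leqNgt; apply/negP => lt_sl.
  by apply: freeH; apply: contains_K cl lt_sl.
exists q => [x|]; first by rewrite q_lt ?inE.
rewrite -(leq_pmul2l (isT : 0 < 2)) -card_ordered_edges ?edges_simple //.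
rewrite -card_ordered_edges ?cross_simple //.
have sumT (f : 'I_n -> 'I_n -> nat) :
    \sum_(x in [set: 'I_n]) \sum_(y in [set: 'I_n]) f x y = \sum_x \sum_y f x y.
  by apply: eq_big => [x|x _]; [rewrite inE | apply: eq_bigl => y; rewrite inE].
rewrite !sumT in le_q; apply: leq_trans le_q _.
by apply: leq_sum => x _; apply: leq_sum => y _; rewrite mem_cross.
Qed.

Lemma cross_free n k (q : 'I_n -> nat) s : (forall x, q x < s) -> s < k ->
  ~ contains (cross_graph q) (K k).
Proof.
move=> q_lt lt_sk [phi [phi_inj phiE]].
have [||x [y [neq_xy eq_q]]] := @pigeonhole_nat 'I_k (q \o phi) s.
- by move=> x; apply: q_lt.
- by rewrite card_ord.
have := phiE [set x; y]; rewrite inE cards2 neq_xy => /(_ isT).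
by rewrite imsetU !imset_set1 mem_cross -[q (phi x)]/((q \o phi) x) eq_q eqxx.
Qed.

(** Complete multipartite graphs are themselves free of large cliques, so the bound
    of [cross_edges_max] is attained. *)
Lemma turan_ex_partition n s : exists2 q : 'I_n -> nat, (forall x, q x < s.+1) &
  turan_ex n (K s.+2) = #|cross_edges q|.
Proof.
rewrite /turan_ex.
pose P (H : sgraph 'I_n) := `[< ~ contains H (K s.+2) >].
pose H0 := cross_graph (fun _ : 'I_n => 0).
have PH0 : P H0 by apply/asboolP; apply: (@cross_free _ _ _ s.+1).
have [H PH maxH] := @arg_maxnP _ H0 P (fun H => #|edges H|) PH0.
have [q q_lt le_q] := cross_edges_max (asboolP _ PH).
exists q => //; apply/eqP; rewrite eqn_leq; apply/andP; split.
  by apply/bigmax_leqP => H' PH'; apply: leq_trans le_q; apply: maxH.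
apply: (@bigmax_sup _ (cross_graph q)) => //.
by apply/asboolP; apply: cross_free q_lt _.
Qed.

(** The residues modulo [s] are the parts of a complete [s]-partite graph; a residue
    class has at most [n / s + 1] elements, whence the error term [s * n]. *)
Lemma turan_ex_ge n s : 0 < s ->
  n ^ 2 * (s - 1) <= s * (2 * turan_ex n (K s.+1)) + s * n.
Proof.
move=> s_gt0; pose q (x : 'I_n) := x %% s.
have q_lt x : q x < s by rewrite ltn_mod.
have le_ex : #|cross_edges q| <= turan_ex n (K s.+1).
  apply: (@bigmax_sup _ (cross_graph q)) => //.
  by apply/asboolP; apply: cross_free q_lt _.
have cardE : 2 * #|cross_edges q| = \sum_x \sum_y (q x != q y : nat).
  rewrite -card_ordered_edges ?cross_simple //.
  by apply: eq_bigr => x _; apply: eq_bigr => y _; rewrite mem_cross.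
have := adj_nonadj_sum (fun x y => q x != q y); rewrite -cardE card_ord.
have : s * \sum_x \sum_y (~~ (q x != q y) : nat) <= n * (n + s).
  rewrite big_distrr /= -[X in X * (n + s)]card_ord -sum_nat_const.
  apply: leq_sum => x _.
  have -> : \sum_y (~~ (q x != q y) : nat) = #|[set y | q x == q y]|.
    rewrite -sum1_card [RHS]big_mkcond; apply: eq_bigr => y _.
    by rewrite inE negbK; case: eqP.
  apply: leq_trans (_ : s * (n %/ s).+1 <= _); last by rewrite mulnS mulnC addnC leq_add2r leq_divM.
  rewrite leq_mul2l; apply/orP; right.
  have lt_y (y : 'I_n) : y %/ s < (n %/ s).+1 by rewrite ltnS leq_div2r // ltnW.
  rewrite -[X in _ <= X]card_ord.
  rewrite -(@card_in_imset _ _ (fun y => Ordinal (lt_y y))); first exact: max_card.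
  move=> y z; rewrite !inE => /eqP qy /eqP qz [eq_yz]; apply: val_inj => /=.
  by rewrite (divn_eq y s) (divn_eq z s) eq_yz -/(q y) -/(q z) -qy -qz.
move: le_ex; move: #|cross_edges q| (turan_ex _ _) (\sum_x _) => a ex b le_ex.
move=> le_b sum_ab.
have : s * (2 * a + b) = s * n ^ 2 by rewrite sum_ab.
rewrite mulnBr muln1 mulnDr.
have : s * (2 * a) <= s * (2 * ex) by rewrite leq_mul2l leq_mul2l le_ex !orbT.
move: le_b; rewrite mulnDr mulnn [n * s]mulnC [n ^ 2 * s]mulnC.
lia.
Qed.

(** * Matchings *)

(** In a matching every vertex lies on exactly one edge; an ordering of each edge
    gives the isomorphism, here as the inverse of [psi]. *)
Lemma matching_iso (V : finType) (G : sgraph V) : no_isolated G ->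
  (forall e f v, e \in edges G -> f \in edges G -> v \in e -> v \in f -> e = f) ->
  isomorphic G (mK2 #|edges G|).
Proof.
move=> noiso disj; set m := #|edges G|.
have /fin_all_exists [u uP] (i : 'I_m) : exists u : V * V,
    u.1 != u.2 /\ enum_val i = [set u.1; u.2].
  have /cards2P [a [b [neq eq]]] := forall_inP (edges_simple G) _ (enum_valP i).
  by exists (a, b).
pose psi (ib : 'I_m * bool) := if ib.2 then (u ib.1).2 else (u ib.1).1.
have psi_in i b : psi (i, b) \in enum_val i.
  by rewrite (uP i).2 /psi !inE; case: b; rewrite eqxx ?orbT.
have psi_inj : injective psi.
  move=> [i b] [j b'] eq_psi.
  have ij : i = j.
    apply: enum_val_inj; apply: (disj _ _ (psi (i, b)));
      rewrite ?enum_valP ?psi_in //.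
    by rewrite eq_psi psi_in.
  move: eq_psi; rewrite -ij /psi /=; have := (uP i).1.
  by case: b; case: b' => //= /eqP neq eq; case: neq.
have /fin_all_exists [phi phiK] (v : V) : exists ib, psi ib = v.
  have [e eG ve] := noiso v; have := (uP (enum_rank_in eG e)).2.
  rewrite enum_rankK_in // => eE; move: ve; rewrite eE !inE.
  by case/orP => /eqP->; [exists (enum_rank_in eG e, false) | exists (enum_rank_in eG e, true)].
have psiK : cancel psi phi by move=> ib; apply: psi_inj; rewrite phiK.
have psiE i : psi @: [set (i, false); (i, true)] = enum_val i.
  by rewrite imsetU !imset_set1 (uP i).2.
exists phi; split; first by exists psi.
move=> e; apply/imsetP/idP => [[i _ eqe]|eG].
  have <- : psi @: (phi @: e) = e.
    by rewrite -imset_comp (eq_imset _ phiK) imset_id.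
  by rewrite eqe psiE enum_valP.
exists (enum_rank_in eG e) => //; apply: (imset_inj psi_inj).
by rewrite psiE enum_rankK_in // -imset_comp (eq_imset _ phiK) imset_id.
Qed.

Lemma isomorphic_card (V W : finType) (G : sgraph V) (H : sgraph W) :
  isomorphic G H -> #|edges G| = #|edges H|.
Proof.
move=> [phi [[psi phiK psiK] phiE]].
rewrite -(card_imset _ (imset_inj (can_inj phiK))); apply: eq_card => e.
apply/imsetP/idP => [[f fG ->]|eH]; first by rewrite phiE.
exists (psi @: e); last by rewrite -imset_comp (eq_imset _ psiK) imset_id.
by rewrite -phiE -imset_comp (eq_imset _ psiK) imset_id.
Qed.

Lemma card_mK2 m : #|edges (mK2 m)| = m.
Proof.
rewrite card_imset ?card_ord // => i j eq_ij.
have : (i, true) \in [set (j, false); (j, true)] by rewrite -eq_ij !inE eqxx orbT.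
by rewrite !inE !xpair_eqE /= andbF andbT => /eqP.
Qed.

Lemma drop_isolatedE (W : finType) (H : sgraph W) :
  [set val @: (e : {set {x : W | x \in cover (edges H)}}) |
     e in edges (drop_isolated H)] = edges H.
Proof.
apply/setP => e; apply/imsetP/idP => [[f]|eH]; first by rewrite inE => fH ->.
have eE : e = val @: [set x : {x : W | x \in cover (edges H)} | val x \in e].
  apply/setP => x; apply/idP/imsetP => [xe|[y]]; last by rewrite inE => ? ->.
  have xc : x \in cover (edges H) by apply/bigcupP; exists e.
  by exists (exist _ x xc) => //; rewrite inE.
by eexists; last exact: eE; rewrite inE -eE.
Qed.

Lemma drop_isolated_card (W : finType) (H : sgraph W) :
  #|edges (drop_isolated H)| = #|edges H|.
Proof.
by rewrite -[X in _ = #|pred_of_set X|]drop_isolatedE card_imset //; apply: imset_inj val_inj.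
Qed.

Lemma drop_isolated_no_isolated (W : finType) (H : sgraph W) :
  no_isolated (drop_isolated H).
Proof.
move=> v; have /bigcupP [e eH ve] := valP v.
have : e \in [set val @: (f : {set {x : W | x \in cover (edges H)}}) |
    f in edges (drop_isolated H)] by rewrite drop_isolatedE.
move=> /imsetP [f fD eE].
by exists f => //; move: ve; rewrite eE mem_imset //; apply: val_inj.
Qed.

Lemma drop_isolated_small_matching (W : finType) (H : sgraph W) r :
  0 < #|edges H| <= r ->
  (forall e f v, e \in edges H -> f \in edges H -> v \in e -> v \in f -> e = f) ->
  small_matchings r (drop_isolated H).
Proof.
move=> cardH disj; exists #|edges H|; split=> //.
rewrite -(drop_isolated_card H); apply: matching_iso => [|e f v].
  exact: drop_isolated_no_isolated.
rewrite !inE => eH fH ve vf; apply: (imset_inj val_inj).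
by apply: (disj _ _ (val v)) => //; rewrite mem_imset //; apply: val_inj.
Qed.

(** * The lower bound *)

Lemma copyK_mem (V W : finType) (phi : V -> W) (phi_inj : injective phi) (e : {set W}) :
  (e \in edges (copy phi_inj (complete V))) <->
  exists x y, x != y /\ e = [set phi x; phi y].
Proof.
split=> [/imsetP[f]|[x [y [neq ->]]]].
  rewrite inE => /cards2P [x [y [neq ->]]] ->.
  by exists x, y; rewrite imsetU !imset_set1.
apply/imsetP; exists [set x; y]; first by rewrite inE cards2 neq.
by rewrite imsetU !imset_set1.
Qed.

Lemma set2_inj (T : finType) (x y z w : T) : [set x; y] = [set z; w] ->
  x = z /\ y = w \/ x = w /\ y = z.
Proof.
move=> eq.
have xP : x \in [set z; w] by rewrite -eq !inE eqxx.
have yP : y \in [set z; w] by rewrite -eq !inE eqxx orbT.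
have zP : z \in [set x; y] by rewrite eq !inE eqxx.
have wP : w \in [set x; y] by rewrite eq !inE eqxx orbT.
move: xP yP zP wP; rewrite !inE.
by do 4!(case/orP => /eqP ?); subst; auto.
Qed.

(** Colour [0] is kept for the pairs inside a fibre of [q]; each other pair has a
    colour of its own. *)
Definition cross_coloring (V : finType) (q : V -> nat) (e : {set V}) : nat :=
  if e \in cross_edges q then (index e (enum (cross_edges q))).+1 else 0.

Lemma cross_coloring0 (V : finType) (q : V -> nat) x y :
  cross_coloring q [set x; y] = 0 <-> q x = q y.
Proof.
by rewrite /cross_coloring mem_cross; case: eqP.
Qed.

Lemma num_colors_cross n (q : 'I_n -> nat) s : (forall x, q x < s) -> s < n ->
  #|cross_edges q| < num_colors (cross_coloring q).
Proof.
move=> q_lt lt_sn; rewrite -[X in X <= _](size_iota 0).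
apply: uniq_leq_size; first exact: iota_uniq.
move=> k; rewrite mem_iota mem_undup add0n ltnS => /andP[_ le_k].
apply/mapP; case: k le_k => [_|k lt_k].
  have [|x [y [neq_xy eq_q]]] := pigeonhole_nat q_lt; first by rewrite card_ord.
  exists [set x; y]; last by symmetry; apply/cross_coloring0.
  by rewrite mem_enum inE cards2 neq_xy.
pose e := nth finset.set0 (enum (cross_edges q)) k.
have eE : e \in cross_edges q by rewrite -mem_enum mem_nth // -cardE.
exists e; first by rewrite mem_enum inE (forall_inP (cross_simple q)).
by rewrite /cross_coloring eE index_uniq ?enum_uniq // -cardE.
Qed.

Lemma ordered_repr (T : finType) (q : T -> nat) : exists rep : T -> T,
  (forall x, q (rep x) = q x) /\ (forall x y, q x = q y -> rep x = rep y).
Proof.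
exists (fun x => odflt x [pick y | q y == q x]); split=> [x|x y eq_q].
  by case: pickP => [y /eqP|//].
by rewrite eq_q; case: pickP => // /(_ y); rewrite eqxx.
Qed.

(** The edges inside the fibres of [q] number at least the vertices minus the
    fibres: each vertex that is not the representative of its fibre is joined to
    that representative, and these edges are distinct. *)
Lemma card_fibre_edges (T : finType) (q : T -> nat) s (E : {set {set T}}) :
  (forall x, q x < s) ->
  (forall x y, x != y -> q x = q y -> [set x; y] \in E) -> #|T| <= s + #|E|.
Proof.
move=> q_lt qE; have [rep [q_rep repP]] := ordered_repr q.
have rep_id x : rep (rep x) = rep x by apply: repP.
rewrite -(cardC [pred x | rep x == x]) leq_add //.
  rewrite -(card_ord s) -(@card_in_imset _ _ (fun x => Ordinal (q_lt x))).
    exact: max_card.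
  move=> x y /eqP rx /eqP ry [/repP]; by rewrite rx ry.
rewrite -(@card_in_imset _ _ (fun x => [set x; rep x])).
  apply: subset_leq_card; apply/subsetP => e /imsetP [x].
  by rewrite inE => rx ->; apply: qE; rewrite 1?eq_sym // q_rep.
move=> x y; rewrite !inE => /eqP rx /eqP ry /set2_inj [[]//|[xE yE]].
by case: rx; rewrite xE rep_id.
Qed.

Lemma edge_other (V : finType) (G : sgraph V) e v : e \in edges G -> v \in e ->
  exists2 a, v != a & e = [set v; a].
Proof.
move=> eG; have /cards2P [a [b [neq ->]]] := forall_inP (edges_simple G) _ eG.
rewrite !inE => /orP[] /eqP->; first by exists b.
by exists a; [rewrite eq_sym | rewrite setUC].
Qed.

(** With [ex + 1] colours, the colouring by an extremal complete multipartite graph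
    defeats both families: the colour class of [0] in a copy of the clique has too
    many edges for a small matching, and it is a disjoint union of complete graphs,
    so that without triangles it is a matching. *)
Lemma turan_lower n s r m : s.+2 + r <= n ->
  forces_copy n (K (s.+2 + r))
    (family_union (small_matchings r) nonmatching_triangle_free) m ->
  turan_ex n (K s.+2) + 2 <= m.
Proof.
move=> le_n forced; rewrite leqNgt addnS ltnS addn1; apply/negP => le_m.
have [q q_lt exE] := turan_ex_partition n s.
have lt_sn : s.+1 < n by lia.
have [|phi [phi_inj FP]] := forced (cross_coloring q).
  by apply: leq_trans le_m _; rewrite exE (num_colors_cross q_lt).
set H := copy phi_inj _ in FP; set p := s.+2 + r in phi phi_inj H FP.
pose M := monochromatic (cross_coloring q) 0 H.
have ME x y : x != y -> ([set phi x; phi y] \in edges M) = (q (phi x) == q (phi y)).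
  move=> neq; rewrite inE; apply/andP/eqP => [[_ /eqP/cross_coloring0]//|eq_q].
  by split; [apply/copyK_mem; exists x, y | apply/eqP/cross_coloring0].
have MP e : e \in edges M -> exists x y, x != y /\ e = [set phi x; phi y].
  by rewrite inE => /andP[/copyK_mem].
have cardM : r < #|edges M|.
  have qphi_lt x : q (phi x) < s.+1 by [].
  have := @card_fibre_edges _ (q \o phi) s.+1 [set phi @^-1: (e : {set 'I_n}) | e in edges M] qphi_lt.
  rewrite card_ord => le_p.
  have : p <= s.+1 + #|edges M|.
    apply: leq_trans (le_p _) _; last by rewrite leq_add2l leq_imset_card.
    move=> x y neq eq_q; apply/imsetP; exists [set phi x; phi y].
      by rewrite ME //; apply/eqP.
    by apply/setP => z; rewrite !inE !(inj_eq phi_inj).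
  by rewrite /p; lia.
have [e0 e0M] : exists e, e \in edges M by apply/card_gt0P; lia.
have [|[k [/andP[_ le_kr] /isomorphic_card]]|[noiso notri]] := FP 0.
- by move: e0M; rewrite inE => /andP[e0H /eqP]; exists e0.
- by rewrite drop_isolated_card card_mK2 => ek; move: cardM; rewrite /M ek ltnNge le_kr.
case; exists #|edges (color_class (cross_coloring q) 0 H)|.
apply: matching_iso => // e f v eG fG ve vf; apply/eqP/negP => neq_ef.
apply: notri.
(* Two edges [v a] and [v b] of the class lie in one fibre, hence so does [a b]. *)
have [a neq_va eE] := edge_other eG ve.
have [b neq_vb fE] := edge_other fG vf.
have neq_ab : a != b by apply: contra_not_neq neq_ef => ab; rewrite eE fE ab.
pose G0 := drop_isolated M.
have adjE x y : adj_of (edges G0) x y = ([set val x; val y] \in edges M).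
  by rewrite /adj_of inE imsetU !imset_set1.
have adj_va : adj_of (edges G0) v a by rewrite /adj_of -eE.
have adj_vb : adj_of (edges G0) v b by rewrite /adj_of -fE.
suff adj_ab : adj_of (edges G0) a b.
  have pw3 (T : Type) (t : rel T) x y z :
    pairwise t [:: x; y; z] = [&& t x y, t x z & t y z] by rewrite /= !andbT andbA.
  by apply: (@contains_K _ _ _ [:: v; a; b]) => //; rewrite pw3 adj_va adj_vb.
rewrite adjE.
have phi_vertex (u : {x : 'I_n | x \in cover (edges M)}) : exists i, val u = phi i.
  have /bigcupP [e' /MP [x [y [_ ->]]]] := valP u.
  by rewrite !inE => /orP[] /eqP ->; [exists x | exists y].
have [[i vE] [j aE]] := (phi_vertex v, phi_vertex a); have [k bE] := phi_vertex b.
have neqE (x y : {x : 'I_n | x \in cover (edges M)}) i' j' :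
  val x = phi i' -> val y = phi j' -> x != y -> i' != j'.
  by move=> xE yE; apply: contra_neq => ij; apply: val_inj; rewrite /= xE yE ij.
have [ij ik] := (neqE _ _ _ _ vE aE neq_va, neqE _ _ _ _ vE bE neq_vb).
have jk := neqE _ _ _ _ aE bE neq_ab.
move: adj_va adj_vb; rewrite !adjE vE aE bE !ME //.
by move=> /eqP<- /eqP<-.
Qed.

(** * The upper bound *)

(** Every candidate [(i, x)] excludes at most one candidate, its enemy, in another
    coordinate.  For a fixed [i], a choice [f] containing [(i, f i)] and its enemy
    can be changed freely in the coordinate of the enemy, so bad choices have
    proportion at most [1 / #|J|]; with fewer than [#|J|] coordinates in [B], some
    choice is good. *)
Lemma conflict_free_choice (I J : finType) (B : {set I}) (enemy : I -> J -> I * J) :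
  (forall i x, (enemy i x).1 != i) -> #|B| < #|J| ->
  exists f : {ffun I -> J},
    forall i, i \in B -> f (enemy i (f i)).1 != (enemy i (f i)).2.
Proof.
move=> enemy_neq lt_BJ.
pose bad i := [set f : {ffun I -> J} | f (enemy i (f i)).1 == (enemy i (f i)).2].
pose upd (f : {ffun I -> J}) j z : {ffun I -> J} :=
  [ffun i => if i == j then z else f i].
have card_bad i : #|bad i| * #|J| <= #|{ffun I -> J}|.
  rewrite -[#|J|]cardsT -cardsX.
  rewrite -(@card_in_imset _ _ (fun u => upd u.1 (enemy i (u.1 i)).1 u.2)).
    exact: max_card.
  move=> [f z] [f' z']; rewrite !inE /= !andbT => /eqP fP /eqP f'P /ffunP eq_upd.
  (* The coordinate [i] is untouched by [upd], so it determines the enemy, the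
     modified coordinate and the value overwritten there. *)
  have eq_i : f i = f' i.
    by have := eq_upd i; rewrite !ffunE ![i == _]eq_sym !(negbTE (enemy_neq _ _)).
  rewrite -eq_i in f'P eq_upd.
  have := eq_upd (enemy i (f i)).1; rewrite !ffunE eqxx => ->.
  congr (_, _); apply/ffunP => j; have := eq_upd j; rewrite !ffunE.
  by case: eqP => [->|//] _; rewrite fP f'P.
have /card_gt0P [x0 _] : 0 < #|J| by apply: leq_ltn_trans lt_BJ.
have ffun_gt0 : 0 < #|{ffun I -> J}| by apply/card_gt0P; exists [ffun=> x0].
apply: contrapT => none.
have cover_bad : #|{ffun I -> J}| <= \sum_(i in B) #|bad i|.
  rewrite -cardsT; apply: leq_trans (_ : #|\bigcup_(i in B) bad i| <= _).
    apply: subset_leq_card; apply/subsetP => f _; apply: contrapT => nbad.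
    apply: none; exists f => i iB; apply/negP => fi; apply: nbad.
    by apply/bigcupP; exists i => //; rewrite inE.
  elim/big_rec2: _ => [|i A b _ le_A]; first by rewrite cards0.
  by apply: leq_trans (leq_card_setU _ _) _; rewrite leq_add2l.
have : #|{ffun I -> J}| * #|J| <= #|B| * #|{ffun I -> J}|.
  apply: leq_trans (leq_mul cover_bad (leqnn _)) _.
  by rewrite big_distrl /= -sum_nat_const; apply: leq_sum.
by rewrite mulnC leq_pmul2r // leqNgt lt_BJ.
Qed.

Lemma rainbow_representatives n (c : {set 'I_n} -> nat) :
  exists E : {set {set 'I_n}}, [/\ E \subset edges (K n), #|E| = num_colors c
    & {in E &, injective c}].
Proof.
set s := undup [seq c e | e <- enum (edges (K n))].
have /fin_all_exists [g gP] (i : 'I_(size s)) : exists e,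
    e \in edges (K n) /\ c e = nth 0 s i.
  have : nth 0 s i \in s by rewrite mem_nth.
  by rewrite mem_undup => /mapP [e]; rewrite mem_enum => eK ->; exists e.
have g_inj : injective (c \o g).
  move=> i j /= /eqP; rewrite (gP i).2 (gP j).2 nth_uniq ?undup_uniq // => /eqP.
  exact: val_inj.
exists [set g i | i : 'I_(size s)]; split.
- by apply/subsetP => _ /imsetP [i _ ->]; apply: (gP i).1.
- by rewrite card_imset ?card_ord //; apply: inj_compr g_inj.
- by move=> _ _ /imsetP [i _ ->] /imsetP [j _ ->] /g_inj ->.
Qed.

Lemma in_box_nth (V : finType) (As : seq {set V}) (l : seq V) x0 :
  size l = size As ->
  (forall i, i < size As -> nth x0 l i \in nth finset.set0 As i) -> in_box As l.
Proof.
rewrite /in_box; elim: As l => [|A As IH] [|x l] //= [size_l] inA.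
by rewrite (inA 0) //= IH // => i lt_i; apply: (inA i.+1).
Qed.

Lemma box_embedding (V J : finType) (adj : rel V) k (As : seq {set V}) :
  symmetric adj -> size As = k -> all [pred A : {set V} | #|A| == #|J|] As ->
  (forall l, in_box As l -> pairwise adj l) ->
  exists a : 'I_k -> J -> V, (forall i, injective (a i)) /\
    forall i j x y, i != j -> adj (a i x) (a j y).
Proof.
move=> adj_sym size_As /allP cardAs clique.
pose A (i : 'I_k) := nth finset.set0 As i.
have cA i : #|A i| = #|J|.
  by apply/eqP; apply: (cardAs (A i)); rewrite mem_nth // size_As.
pose a i x := enum_val (cast_ord (esym (cA i)) (enum_rank x)).
have a_lt (i j : 'I_k) x y : i < j -> adj (a i x) (a j y).
  move=> lt_ij; pose f (h : 'I_k) := a h (if h == i then x else y).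
  pose l := [seq f h | h <- enum 'I_k].
  have size_l : size l = k by rewrite size_map size_enum_ord.
  have nth_l (h : 'I_k) : nth (f i) l h = f h.
    by rewrite (nth_map i) ?size_enum_ord // nth_ord_enum.
  have : pairwise adj l.
    apply: clique; apply: (@in_box_nth _ _ _ (f i)); rewrite size_As // => h lt_h.
    by rewrite (nth_l (Ordinal lt_h)) enum_valP.
  move/(pairwiseP (f i))/(_ i j); rewrite !inE size_l !ltn_ord !nth_l /f eqxx.
  by have /negbTE -> : j != i; [rewrite neq_ltn lt_ij orbT | apply].
exists a; split=> [i x y /enum_val_inj/cast_ord_inj/enum_rank_inj //|i j x y].
by rewrite neq_ltn => /orP[/a_lt //|/a_lt ?]; rewrite adj_sym.
Qed.

(** The index of a vertex inside its part is split into a pair number in ['I_r.+1]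
    and a bit; [f] selects one pair in each part, and the clique uses both vertices
    of it in the first [r] parts, one in the others.  One pair more than [r] per
    part is what [conflict_free_choice] asks for. *)
Lemma rainbow_box_clique n k r (c : {set 'I_n} -> nat) (E : {set {set 'I_n}})
    (a : 'I_k.+2 -> 'I_r.+1 * bool -> 'I_n) :
  0 < r -> r <= k.+2 -> simple_edges E -> {in E &, injective c} ->
  (forall i, injective (a i)) ->
  (forall i j x y, i != j -> adj_of E (a i x) (a j y)) ->
  exists (phi : 'I_(k.+2 + r) -> 'I_n) (phi_inj : injective phi), forall col,
    color_occurs c col (copy phi_inj (K (k.+2 + r))) ->
    small_matchings r (color_class c col (copy phi_inj (K (k.+2 + r)))).
Proof.
move=> r_gt0 le_rk simpleE c_inj a_inj a_adj.
have a_inj2 i j x y : a i x = a j y -> i = j /\ x = y.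
  have [<- /a_inj //|neq eq_a] := eqVneq i j.
  by have := a_adj i j x y neq; rewrite eq_a adj_of_irr.
pose inner i x := [set a i (x, false); a i (x, true)].
(* Only one edge between parts can have the colour of a given inner pair, as [c]
   is injective on [E].  At least one end of that edge lies outside part [i]; the
   pair containing this end is the enemy. *)
have /fin_all_exists [enemy enemyP] (ix : 'I_k.+2 * 'I_r.+1) :
    exists w : 'I_k.+2 * 'I_r.+1, w.1 != ix.1 /\
      forall j j' y y' b b', j != j' ->
        c [set a j (y, b); a j' (y', b')] = c (inner ix.1 ix.2) ->
        w = (j, y) \/ w = (j', y').
  case: ix => i x /=.
  have [[j [j' [y [y' [b [b' [neq_j col]]]]]]]|none] := pselect (exists j j' y y' b b',
      j != j' /\ c [set a j (y, b); a j' (y', b')] = c (inner i x)); last first.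
    exists (lift i ord0, ord0); split; first by rewrite eq_sym neq_lift.
    move=> j j' y y' b b' neq col; case: none.
    by exists j, j', y, y', b, b'.
  have uniq_edge l l' z z' d d' : l != l' ->
    c [set a l (z, d); a l' (z', d')] = c (inner i x) ->
    (j, y) = (l, z) /\ (j', y') = (l', z') \/ (j, y) = (l', z') /\ (j', y') = (l, z).
    move=> neq_l; rewrite -col => /c_inj eq_e.
    have /set2_inj [] := eq_e (a_adj _ _ _ _ neq_l) (a_adj _ _ _ _ neq_j).
      move=> [/a_inj2 [-> [-> _]] /a_inj2 [-> [-> _]]]; by left.
    move=> [/a_inj2 [-> [-> _]] /a_inj2 [-> [-> _]]]; by right.
  have [ji|neq_ji] := eqVneq j i.
    exists (j', y'); rewrite /= -ji eq_sym; split=> // l l' z z' d d' neq_l.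
    by rewrite ji => /(uniq_edge _ _ _ _ _ _ neq_l) [] [_ ->]; auto.
  exists (j, y); split=> // l l' z z' d d' neq_l.
  by move=> /(uniq_edge _ _ _ _ _ _ neq_l) [] [-> _]; auto.
pose B := [set widen_ord le_rk i | i : 'I_r].
have cardB : #|B| <= r by rewrite -[X in _ <= X]card_ord leq_imset_card.
have [||f fP] := @conflict_free_choice _ _ B (fun i x => enemy (i, x)).
- by move=> i x; case: (enemyP (i, x)).
- by rewrite card_ord ltnS.
pose part (v : 'I_(k.+2 + r)) :=
  match fintype.split v with inl i => i | inr i => widen_ord le_rk i end.
pose bit (v : 'I_(k.+2 + r)) := if fintype.split v is inl _ then false else true.
pose phi v := a (part v) (f (part v), bit v).
have phi_inj : injective phi.
  move=> v w /a_inj2 [eq_part [_]]; move: eq_part; rewrite /part /bit => eq_part eq_bit.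
  apply: (can_inj (@splitK _ _)); move: eq_part eq_bit.
  case: (fintype.split v) => i; case: (fintype.split w) => j //; first by move=> ->.
  by move=> /(congr1 val) /= eq_ij _; congr inr; apply: val_inj.
exists phi, phi_inj => col [e0 e0H e0c].
set H := copy phi_inj _ in e0H *.
pose M := monochromatic c col H.
have edgeP e : e \in edges H ->
    (exists v w, part v != part w /\ e = [set phi v; phi w]) \/
    (exists2 i, i \in B & e = inner i (f i)).
  move/copyK_mem => [v [w [neq_vw ->]]].
  have [eq_part|neq_part] := eqVneq (part v) (part w); last by left; exists v, w.
  right; have neq_bit : bit v != bit w.
    apply: contra_neq neq_vw => eq_bit; apply: (phi_inj).
    by rewrite /phi eq_part eq_bit.
  exists (part v).
    move: eq_part neq_bit; rewrite /part /bit.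
    case: (fintype.split v) => [i|i] /=; last by rewrite imset_f.
    by case: (fintype.split w) => [//|j] -> _; rewrite imset_f.
  rewrite /inner /phi -eq_part; case: (bit v) neq_bit; case: (bit w) => // _.
  by rewrite finset.setUC.
have no_conflict v w i : part v != part w -> i \in B ->
    c [set phi v; phi w] <> c (inner i (f i)).
  move=> neq iB col_eq; have [_ /(_ _ _ _ _ _ _ neq col_eq)] := enemyP (i, f i).
  by have := fP i iB; case=> [] ne [] en; move: ne; rewrite en /= eqxx.
have cross_in v w : part v != part w -> [set phi v; phi w] \in E.
  by move=> neq; apply: a_adj.
have M_gt0 : 0 < #|edges M|.
  by apply/card_gt0P; exists e0; rewrite inE e0H e0c eqxx.
(* A class with an edge between parts is that single edge; any other class is a
   set of inner edges, which are disjoint and at most [r] many. *)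
have [[v [w [neq_vw]]]|no_cross] := pselect (exists v w, part v != part w /\
    [set phi v; phi w] \in edges M).
  rewrite inE => /andP[vwH /eqP vwc].
  have allM e : e \in edges M -> e = [set phi v; phi w].
    rewrite inE => /andP[/edgeP [[v' [w' [neq ->]]]|[i iB ->]] /eqP ec].
      by apply: c_inj; rewrite ?cross_in // ec vwc.
    by case: (no_conflict v w i neq_vw iB); rewrite vwc ec.
  apply: (@drop_isolated_small_matching _ M) => [|e g u /allM-> /allM->//].
  rewrite M_gt0 andTb (leq_trans _ r_gt0) // -(cards1 [set phi v; phi w]).
  by apply: subset_leq_card; apply/subsetP => e /allM ->; rewrite inE.
have allM e : e \in edges M -> exists2 i, i \in B & e = inner i (f i).
  move=> eM; have := eM; rewrite inE => /andP[/edgeP [[v [w [neq eE]]]|//] _].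
  by case: no_cross; exists v, w; rewrite -eE.
apply: (@drop_isolated_small_matching _ M) => [|e g u /allM [i _ ->] /allM [j _ ->]].
  rewrite M_gt0 andTb (leq_trans _ cardB) // (leq_trans _ (leq_imset_card (fun i => inner i (f i)) _)) //.
  apply: subset_leq_card; apply/subsetP => e /allM [i iB ->].
  by apply/imsetP; exists i.
rewrite !inE => ui uj; suff -> : i = j by [].
case/orP: ui => /eqP->{u} in uj *; by case/orP: uj => /eqP /a_inj2 [].
Qed.

(** Slightly more than [(1 + 1/q) ex] colours: as [ex] is about
    [(1 - 1/s) n ^ 2 / 2] with [s = k + 2], one edge of each colour makes a graph to
    which the Erdos-Stone theorem applies with density parameter [4 q]. *)
Lemma forces_many_colors k r q : 0 < r -> r <= k.+3 -> exists N, forall n, N <= n ->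
  forall m, q.+1 * turan_ex n (K k.+3) < q * m ->
  forces_copy n (K (k.+3 + r)) (small_matchings r) m.
Proof.
move=> r_gt0 le_rk.
have [N ES] := @erdos_stone k.+2 #|{: 'I_r.+1 * bool}| (4 * q) isT
  ltac:(by apply/card_gt0P; exists (ord0, true)).
exists (N + 2 * q.+1 * k.+2) => n le_n m lt_m c le_mc.
have [E [E_K cardE c_inj]] := rainbow_representatives c.
have simpleE : simple_edges E.
  by apply/forall_inP => e /(subsetP E_K); rewrite inE.
have [||As [size_As cardAs] clique] := ES _ _ (adj_of_sym E) (adj_of_irr simpleE).
- by rewrite card_ord; lia.
- have := adj_nonadj_sum (adj_of E); rewrite card_ordered_edges // card_ord cardE.
  have := @turan_ex_ge n k.+2 isT.
  have le_qm : q * m <= q * num_colors c by rewrite leq_mul2l le_mc orbT.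
  have le_sn : 2 * q.+1 * k.+2 * n <= n ^ 2 by rewrite -mulnn leq_mul2r; lia.
  rewrite subn1 /=.
  move: (num_colors c) (turan_ex _ _) (\sum_x _) le_qm lt_m => C ex b le_qm lt_m.
  move: (n ^ 2) le_sn => X le_sn le_ex sum_C.
  have h1 : 4 * q.+1 * (X * k.+1) <= 4 * q.+1 * (k.+2 * (2 * ex) + k.+2 * n).
    by rewrite leq_mul2l le_ex orbT.
  have h2 : 8 * k.+2 * (q.+1 * ex) <= 8 * k.+2 * (q * C) by rewrite leq_mul2l; lia.
  have h3 : 4 * q * k.+2 * (2 * C + b) = 4 * q * k.+2 * X by rewrite sum_C.
  lia.
have [a [a_inj a_adj]] := box_embedding (adj_of_sym E) size_As cardAs clique.
exact: rainbow_box_clique a_adj.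
Qed.

(** * Asymptotics *)

Lemma min_colors_forces (V : finType) n (G : sgraph V) F :
  forces_copy n G F (min_colors n G F).
Proof. by rewrite /min_colors; case: ex_minnP => m /asboolP. Qed.

Lemma min_colors_le (V : finType) n (G : sgraph V) F m :
  forces_copy n G F m -> min_colors n G F <= m.
Proof. by rewrite /min_colors; case: ex_minnP => m0 _ min_m0 forced; apply: min_m0; apply/asboolP. Qed.

Lemma forces_copy_union (V : finType) n (G : sgraph V) (F1 F2 : Defs.family) m :
  forces_copy n G F1 m -> forces_copy n G (family_union F1 F2) m.
Proof.
move=> forced c /forced [phi [phi_inj FP]]; exists phi, phi_inj => col occ.
by left; apply: FP.
Qed.

Lemma turan_ex_unbounded k n q : 4 * q + 3 <= n -> q <= turan_ex n (K k.+3).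
Proof.
move=> le_n; have := @turan_ex_ge n k.+2 isT; rewrite subn1 /=.
rewrite leqNgt => /negP le_ex; rewrite leqNgt; apply/negP => lt_ex; apply: le_ex.
have h1 : k.+2 * (2 * turan_ex n (K k.+3)) <= k.+2 * (2 * q) by rewrite leq_mul2l; lia.
have h2 : (4 * q + 3) * n * k.+1 <= n ^ 2 * k.+1 by rewrite leq_mul2r -mulnn leq_mul2r le_n !orbT.
have h3 : 4 * q * k.+1 <= 4 * q * k.+1 * n by rewrite leq_pmulr //; lia.
have h4 : k.+1 <= k.+1 * n by rewrite leq_pmulr //; lia.
nia.
Qed.

Lemma turan_ex_gt0 k n : 4 <= n -> 0 < turan_ex n (K k.+3).
Proof.
move=> le_n; have := @turan_ex_ge n k.+2 isT; rewrite subn1 /= lt0n => le_ex.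
apply/eqP => ex0; move: le_ex; rewrite ex0 muln0 muln0 add0n.
apply/negP; rewrite -ltnNge -mulnn.
have : 4 * (n * k.+1) <= n * n * k.+1 by rewrite mulnA leq_mul2r leq_mul2r le_n !orbT.
nia.
Qed.

Lemma min_colors_upper k r q : 0 < r -> r <= k.+3 -> 0 < q -> exists N, forall n, N <= n ->
  q * min_colors n (K (k.+3 + r)) (small_matchings r) <= (q + 2) * turan_ex n (K k.+3).
Proof.
move=> r_gt0 le_rk q_gt0; have [N forced] := @forces_many_colors k r q r_gt0 le_rk.
exists (N + (4 * q + 3)) => n le_n.
have le_ex : q <= turan_ex n (K k.+3) by apply: turan_ex_unbounded; lia.
set ex := turan_ex _ _ in le_ex *.
have div_le := leq_divM ex q; have div_gt := ltn_ceil ex q_gt0.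
(* The least number of colours above [(1 + 1/q) ex]. *)
have le_min : min_colors n (K (k.+3 + r)) (small_matchings r) <= ex + ex %/ q + 1.
  apply: min_colors_le; apply: forced; first by lia.
  by rewrite -/ex mulSn !mulnDr muln1; lia.
apply: leq_trans (_ : q * (ex + ex %/ q + 1) <= _).
  by rewrite leq_mul2l le_min orbT.
by rewrite !mulnDr mulnDl muln1; lia.
Qed.

Local Open Scope ring_scope.
Import Order.TTheory GRing.Theory Num.Theory.

(** Since [ex <= f], the quotient [f n / ex n - 1] is nonnegative, and the bounds
    [f n <= (1 + 2/q) ex n] make it tend to [0]. *)
Lemma ratio_asymptotics (R : realType) (f ex : nat -> nat) (p : nat) :
  (forall n, p <= n -> 0 < ex n)%N -> (forall n, p <= n -> ex n <= f n)%N ->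
  (forall q, 0 < q -> exists N, forall n, N <= n -> q * f n <= (q + 2) * ex n)%N ->
  exists o : nat -> R, (o @ \oo --> (0 : R))%classic /\
    forall n : nat, (p <= n)%N -> (f n)%:R <= (1 + o n) * (ex n)%:R.
Proof.
move=> ex_gt0 le_exf upper; exists (fun n => (f n)%:R / (ex n)%:R - 1); split; last first.
  move=> n le_pn; rewrite addrC subrK divfK // pnatr_eq0 -lt0n; exact: ex_gt0.
apply/cvgr0Pnorm_lt => e e_gt0.
set q := (Num.bound (2 / e)).+1.
have q_gt : 2 < e * q%:R.
  rewrite mulrC -ltr_pdivrMr //; apply: lt_trans (archi_boundP _) _.
    by rewrite divr_ge0 // ltW.
  by rewrite ltr_nat.
have [N leN] := upper q isT.
exists (maxn N p) => // n /=; rewrite geq_max => /andP[le_Nn le_pn].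
have exR_gt0 : 0 < (ex n)%:R :> R by rewrite ltr0n ex_gt0.
have fE : `|(f n)%:R / (ex n)%:R - 1| = ((f n)%:R - (ex n)%:R) / (ex n)%:R :> R.
  rewrite mulrBl divff ?gt_eqF // ger0_norm // subr_ge0 ler_pdivlMr // mul1r.
  by rewrite ler_nat le_exf.
rewrite fE ltr_pdivrMr //.
have := leN n le_Nn; rewrite -(ler_nat R) !natrM natrD => le_q.
rewrite -(ltr_pM2l (_ : 0 < q%:R)) ?ltr0n //.
apply: le_lt_trans (_ : 2 * (ex n)%:R < _).
  by rewrite mulrBr lerBlDr addrC -mulrDl.
by rewrite mulrA [q%:R * e]mulrC ltr_pM2r.
Qed.

Theorem theorem4p10 (R : realType) (r p : nat) (hr : (1 <= r)%N)
    (hp : ((2 <= r)%N /\ (2 * r < p)%N) \/ (r = 1%N /\ (4 <= p)%N)) :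
  ((forall n : nat, (p <= n)%N ->
      (turan_ex n (K (p - r)) + 2 <= min_colors n (K p) (small_matchings r))%N)
   /\
   (exists o : nat -> R,
      (o @ \oo --> (0 : R))%classic /\
      forall n : nat, (p <= n)%N ->
        (min_colors n (K p) (small_matchings r))%:R
          <= (1 + o n) * (turan_ex n (K (p - r)))%:R))
  /\
  ((forall n : nat, (p <= n)%N ->
      (turan_ex n (K (p - r)) + 2
         <= min_colors n (K p)
              (family_union (small_matchings r) nonmatching_triangle_free))%N)
   /\
   (exists o : nat -> R,
      (o @ \oo --> (0 : R))%classic /\
      forall n : nat, (p <= n)%N ->
        (min_colors n (K p)
           (family_union (small_matchings r) nonmatching_triangle_free))%:R
          <= (1 + o n) * (turan_ex n (K (p - r)))%:R)).
Proof.
have [k pE] : exists k, p = (k.+3 + r)%N by exists (p - r - 3)%N; lia.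
have le_rk : (r <= k.+3)%N by lia.
move: hp => _; rewrite {}pE addnK.
have n_ge4 n : (k.+3 + r <= n)%N -> (4 <= n)%N by lia.
have le_small n : (min_colors n (K (k.+3 + r))
      (family_union (small_matchings r) nonmatching_triangle_free)
    <= min_colors n (K (k.+3 + r)) (small_matchings r))%N.
  exact/min_colors_le/forces_copy_union/min_colors_forces.
have lower n : (k.+3 + r <= n)%N -> (turan_ex n (K k.+3) + 2
    <= min_colors n (K (k.+3 + r))
         (family_union (small_matchings r) nonmatching_triangle_free))%N.
  by move=> le_n; apply: (@turan_lower n k.+1 r _ le_n); apply: min_colors_forces.
have lower_small n le_n := leq_trans (lower n le_n) (le_small n).
split; split=> //; apply: ratio_asymptotics => [n /n_ge4|n le_n|q q_gt0].
- exact: turan_ex_gt0.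
- exact: leq_trans (leq_addr _ _) (lower_small n le_n).
- exact: min_colors_upper.
- exact: turan_ex_gt0.
- exact: leq_trans (leq_addr _ _) (lower n le_n).
have [N leN] := min_colors_upper hr le_rk q_gt0.
by exists N => n /leN; apply: leq_trans; rewrite leq_mul2l le_small orbT.
Qed.
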